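(* There exists a tree in $\mathbb{R}^3$ with $12$ edges that covers all $27$ points of the grid $G_3 = \{0,1,2\}^3 \subset \mathbb{R}^3$.
   Context: A tree in $\mathbb{R}^k$ is any acyclic connected arrangement of (finitely many) line segments in $\mathbb{R}^k$; the line segments are the edges of the tree, the endpoints of the segments are its vertices (these may be arbitrary points of $\mathbb{R}^k$, not necessarily grid points), and the size of the tree is its number of edges. A tree covers a set of points if every point of the set lies on at least one edge of the tree. *)

(* Defs.v *)
From mathcomp Require Import all_boot all_order all_algebra.
From mathcomp Require Import all_classical all_reals all_analysis.
Set Implicit Arguments.
Unset Strict Implicit.
Unset Printing Implicit Defensive.
Import Order.TTheory GRing.Theory Num.Theory.
Import numFieldNormedType.Exports.
Local Open Scope classical_set_scope.
Local Open Scope ring_scope.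

Definition segment (R : realType) (k : nat)
    (e : 'rV[R]_k * 'rV[R]_k) : set 'rV[R]_k :=
  [set (1 - t) *: e.1 + t *: e.2 | t in `[0%R, 1%R]].

Definition support (R : realType) (k n : nat)
    (T : 'I_n -> 'rV[R]_k * 'rV[R]_k) : set 'rV[R]_k :=
  \bigcup_(i in [set: 'I_n]) segment (T i).

(* A set contains a simple closed curve when some closed path running inside
   it is injective apart from its coinciding ends. *)
Definition has_simple_closed_curve (R : realType) (k : nat)
    (A : set 'rV[R]_k) : Prop :=
  exists c : R -> 'rV[R]_k,
    [/\ {within `[0%R, 1%R], continuous c},
        c 0 = c 1,
        {in `[0%R, 1%R[ &, injective c} &
        c @` `[0%R, 1%R] `<=` A].

(* A family of n segments, each given by its two endpoints, is a tree of
   size n.  As for any arrangement of segments, edges may meet at points that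
   are not endpoints; connectedness and acyclicity are those of the union of
   the edges.  The condition that two edges share at most one point excludes
   repeated and overlapping collinear edges, a degenerate kind of cycle which
   the union does not see. *)
Definition is_tree (R : realType) (k n : nat)
    (T : 'I_n -> 'rV[R]_k * 'rV[R]_k) : Prop :=
  [/\ forall i, (T i).1 != (T i).2,
      forall i j, i != j ->
        is_subset1 (segment (T i) `&` segment (T j)),
      connected (support T) &
      ~ has_simple_closed_curve (support T)].

Definition covers (R : realType) (k n : nat)
    (T : 'I_n -> 'rV[R]_k * 'rV[R]_k) (A : set 'rV[R]_k) : Prop :=
  forall p, A p -> exists i, segment (T i) p.

Definition grid (R : realType) (k : nat) : set 'rV[R]_k :=
  [set p | forall j, p ord0 j \in [:: 0; 1; 2]].

(* Main.v *)
Require Import Defs.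
From mathcomp Require Import all_boot all_order all_algebra.
From mathcomp Require Import all_classical all_reals all_analysis.
From mathcomp Require Import lra zify.

(** Nine of the twelve edges contain three grid points, the other three contain
    only two; the latter form a path through the two points [(2, 4, -1)] and
    [(-1, -2, 2)] outside the grid, and each of them is crossed at a further
    point off the grid by one of the former.  Ordered suitably, every edge meets
    the union of the preceding ones in exactly one point.  Such a one-point
    attachment of closed sets creates no simple closed curve: a curve reaching
    both sides would have to cross the common point on each of its two arcs.  A
    single segment contains none because a closed real-valued curve takes any
    value between those at [0] and [1/2] on both halves of its domain. *)

Set Implicit Arguments.
Unset Strict Implicit.
Unset Printing Implicit Defensive.
Import Order.TTheory GRing.Theory Num.Theory.
Import numFieldNormedType.Exports.
Local Open Scope classical_set_scope.
Local Open Scope ring_scope.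

(** * Closed curves in a union of two closed sets with one common point *)

Lemma connected_closed_cover (T : topologicalType) (D A B : set T) :
  connected D -> closed A -> closed B -> D `<=` A `|` B ->
  D `&` A !=set0 -> D `&` B !=set0 -> D `&` (A `&` B) !=set0.
Proof.
move=> Dc Ac Bc DAB DA0 [y [Dy By]].
apply: contrapT => DAB0.
have DAE : D `&` A = D.
  apply: Dc => //; last by exists A.
  (* If [D] misses the intersection of [A] and [B], then inside [D] lying in [A] amounts to lying
     outside [B], so the trace of [A] is open as well as closed in [D]. *)
  exists (~` B); first exact: closed_openC.
  apply/seteqP; split=> x [Dx H]; split=> //.
    by move=> Bx; apply: DAB0; exists x.
  by case: (DAB x Dx).
have [_ Ay] : (D `&` A) y by rewrite DAE.
by apply: DAB0; exists y.
Qed.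

Section Curves.
Context (R : realType) (V : topologicalType).
Implicit Types (A B : set V) (c : R -> V) (p : V) (u v : R).

Lemma curve_through_separator A B p c u v :
  closed A -> closed B -> A `&` B `<=` [set p] -> u <= v ->
  {within `[u, v], continuous c} -> c @` `[u, v] `<=` A `|` B ->
  (A (c u) /\ B (c v)) \/ (B (c u) /\ A (c v)) ->
  exists2 t, t \in `[u, v] & c t = p.
Proof.
move=> Ac Bc ABp uv cc cAB H.
have Dc : connected (c @` `[u, v]).
  by apply: connected_continuous_connected => //; exact: segment_connected.
have Du : (c @` `[u, v]) (c u) by exists u => //=; rewrite in_itv /= lexx.
have Dv : (c @` `[u, v]) (c v) by exists v => //=; rewrite in_itv /= lexx uv.
have [|||_ [[t tuv <-] /ABp ctp]] := connected_closed_cover Dc Ac Bc.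
- exact: cAB.
- by case: H => -[? ?]; [exists (c u)|exists (c v)].
- by case: H => -[? ?]; [exists (c v)|exists (c u)].
- by exists t.
Qed.

(* One of the two arcs of the closed curve joining [c u] to [c v] is [`[u, v]];
   the other one is cut at the base point [c 0 = c 1], and the half of it that
   already joins [A] to [B] is used. Both pass through [p]. *)
Lemma closed_curve_not_across A B p c u v :
  closed A -> closed B -> A p -> B p -> A `&` B `<=` [set p] ->
  {within `[0, 1], continuous c} -> c 0 = c 1 ->
  {in `[0, 1[ &, injective c} -> c @` `[0, 1] `<=` A `|` B ->
  0 <= u -> u <= v -> v < 1 -> c u <> p -> c v <> p ->
  ~ (A (c u) /\ B (c v)).
Proof.
move=> Ac Bc Ap Bp ABp cc c01 cinj cAB u0 uv v1 cup cvp [Au Bv].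
have sub a b : 0 <= a -> b <= 1 -> `[a, b] `<=` (`[0, 1] : set R).
  move=> a0 b1 t /=; rewrite !in_itv /= => /andP[at_ tb].
  by rewrite (le_trans a0 at_) (le_trans tb b1).
have thr a b : 0 <= a -> a <= b -> b <= 1 ->
    (A (c a) /\ B (c b)) \/ (B (c a) /\ A (c b)) ->
    exists2 t, t \in `[a, b] & c t = p.
  move=> a0 ab b1; apply: curve_through_separator => //.
    by apply: continuous_subspaceW cc; exact: sub.
  by apply: subset_trans cAB; apply: image_subset; exact: sub.
have [||||t tuv ctp] := thr u v; rewrite ?(ltW v1) //; first by left.
have {}tuv : u < t < v.
  move: tuv; rewrite in_itv /= => /andP[ut tv]; rewrite !lt_neqAle ut tv !andbT.
  by apply/andP; split; apply/eqP => tE;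
    [apply: cup; rewrite tE|apply: cvp; rewrite -tE].
have [s suv csp] : exists2 s, (0 <= s <= u) || (v <= s < 1) & c s = p.
  have : (A `|` B) (c 0).
    by apply: cAB; exists 0 => //=; rewrite in_itv /= lexx ler01.
  case=> [A0|B0].
    have [||||s sv csp] := thr v 1; rewrite ?(ltW v1) ?(le_trans u0 uv) //.
      by right; rewrite -c01.
    move: sv; rewrite in_itv /= => /andP[vs].
    (* Injectivity stops short of 1, so a passage through [p] at parameter 1 is moved to 0. *)
    rewrite le_eqVlt => /predU1P[s1|s1].
      by exists 0; rewrite ?lexx ?u0 // c01 -s1.
    by exists s; rewrite ?vs ?s1 ?orbT.
  have [||||s su csp] := thr 0 u; rewrite ?(le_trans uv (ltW v1)) //.
    by right.
  by exists s => //; move: su; rewrite in_itv /= => ->.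
(* Both parameters lie in [[0, 1[] and are sent to [p], but only [t] lies strictly between [u] and
   [v]. *)
have : t = s.
  apply: cinj; rewrite ?csp ?ctp // ?in_itv /=; lra.
lra.
Qed.

End Curves.

Lemma simple_closed_curveU (R : realType) (k : nat) (A B : set 'rV[R]_k)
    (p : 'rV[R]_k) :
  closed A -> closed B -> A p -> B p -> A `&` B `<=` [set p] ->
  has_simple_closed_curve (A `|` B) ->
  has_simple_closed_curve A \/ has_simple_closed_curve B.
Proof.
move=> Ac Bc Ap Bp ABp [c [cc c01 cinj cAB]].
have in01 t : t \in `[0, 1] -> (A `|` B) (c t).
  by move=> t01; apply: cAB; exists t.
(* A point missed at parameter 1 is also the point at 0, so the parameter can be kept below 1. *)
have outside (E : set 'rV[R]_k) : ~ (c @` `[0, 1] `<=` E) ->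
    exists2 t, 0 <= t < 1 & ~ E (c t).
  move=> /existsNP[_ /not_implyP[[t t01 <-] Et]].
  move: t01; rewrite /= in_itv /= => /andP[t0].
  rewrite le_eqVlt => /predU1P[t1|t1]; last by exists t; rewrite ?t0.
  by exists 0; rewrite ?lexx ?ltr01 // c01 -t1.
have [cA|/outside[u /andP[u0 u1] NAu]] := pselect (c @` `[0, 1] `<=` A).
  by left; exists c.
have [cB|/outside[v /andP[v0 v1] NBv]] := pselect (c @` `[0, 1] `<=` B).
  by right; exists c.
exfalso.
have Bu : B (c u).
  by case: (in01 u) => //; rewrite in_itv /= u0 ltW.
have Av : A (c v).
  by case: (in01 v) => //; rewrite in_itv /= v0 ltW.
have cup : c u <> p by move=> cup; apply: NAu; rewrite cup.
have cvp : c v <> p by move=> cvp; apply: NBv; rewrite cvp.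
(* The two orders of [u] and [v] exchange the roles of [A] and [B]. *)
have [uv|/ltW vu] := leP u v.
  apply: (@closed_curve_not_across _ _ B A p c u v) => //.
    by rewrite setIC.
  by rewrite setUC.
exact: (@closed_curve_not_across _ _ A B p c v u).
Qed.

(** * Single segments *)

Lemma closed_real_curve_not_injective (R : realType) (g : R -> R) :
  {within `[0, 1], continuous g} -> g 0 = g 1 -> ~ {in `[0, 1[ &, injective g}.
Proof.
move=> gc g01 ginj; pose h : R := 2^-1; pose y := (g 0 + g h) / 2.
have h0 : 0 < h < 1 by rewrite /h; lra.
have g0h : g 0 <> g h.
  move=> g0h; suff : 0 = h by lra.
  by apply: ginj => //; rewrite in_itv /=; lra.
have ivt a b : 0 <= a -> a <= b -> b <= 1 ->
    Num.min (g a) (g b) <= y <= Num.max (g a) (g b) ->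
    exists2 t, t \in `[a, b] & g t = y.
  move=> a0 ab b1 yab; apply: IVT => //.
  apply: continuous_subspaceW gc => t /=; rewrite !in_itv /=; lra.
have [||||s sh gs] := ivt 0 h; try lra.
  by rewrite /y; case: (ltP (g 0) (g h)); lra.
have [||||t th gt] := ivt h 1; try lra.
  by rewrite -g01 /y; case: (ltP (g h) (g 0)); lra.
move: sh th; rewrite !in_itv /= => sh th.
(* The two halves share only [h], where [g] does not take the midpoint value [y]; nor does it at 1,
   since [g 1 = g 0], so injectivity applies to [t]. *)
have sNh : s <> h by move=> sE; move: gs; rewrite sE /y; lra.
have t1 : t <> 1 by move=> tE; move: gt; rewrite tE -g01 /y; lra.
have st : s = t.
  apply: ginj; rewrite ?gs ?gt // in_itv /=; last by move/eqP: t1; lra.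
  lra.
by apply: sNh; lra.
Qed.

(** A coordinate in which the endpoints differ is injective on the segment and reduces the claim to
    a real-valued curve. If the endpoints coincide, the curve is constant. *)
Lemma segment_no_simple_closed_curve (R : realType) (k : nat)
    (e : 'rV[R]_k * 'rV[R]_k) :
  ~ has_simple_closed_curve (segment e).
Proof.
case: e => a b [c [cc c01 cinj cS]].
have in01 t : t \in `[0, 1[ -> exists x, c t = (1 - x) *: a + x *: b.
  rewrite in_itv /= => /andP[t0 /ltW t1].
  have [|x _ <-] := cS (c t); last by exists x.
  by exists t => //=; rewrite in_itv /= t0.
have [[j abj]|abE] := pselect (exists j, a ord0 j != b ord0 j); last first.
  have cE t : t \in `[0, 1[ -> c t = a.
    move=> /in01[x ->]; suff -> : b = a by rewrite -scalerDl subrK scale1r.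
    apply/rowP => j; apply/eqP/negPn/negP => baj.
    by apply: abE; exists j; rewrite eq_sym.
  have zero01 : 0 \in `[(0 : R), 1[ by rewrite in_itv /=; lra.
  have half01 : 2^-1 \in `[(0 : R), 1[ by rewrite in_itv /=; lra.
  suff : (0 : R) = 2^-1 by lra.
  by apply: cinj => //; rewrite !cE.
apply: (@closed_real_curve_not_injective _ (fun t => c t ord0 j)).
- apply: (@within_continuous_comp _ _ _ _ c (fun M : 'rV[R]_k => M ord0 j)) => //.
  by move=> x _; exact: coord_continuous.
- by rewrite c01.
move=> s t s01 t01; have [x sE] := in01 s s01; have [y tE] := in01 t t01.
move=> cst; apply: cinj => //; rewrite sE tE; suff -> : x = y by [].
apply: (@mulIf _ (b ord0 j - a ord0 j)); first by rewrite subr_eq0 eq_sym.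
by move: cst; rewrite sE tE !mxE; lra.
Qed.

Section SegmentTopology.
Context (R : realType) (k : nat) (e : 'rV[R]_k * 'rV[R]_k).

Lemma segment_param_continuous :
  continuous (fun t : R => (1 - t) *: e.1 + t *: e.2).
Proof.
move=> t; apply: cvgD; apply: cvgZr_tmp => //.
by apply: cvgB => //; exact: cvg_cst.
Qed.

Lemma closed_segment : closed (segment e).
Proof.
apply: compact_closed; first exact: norm_hausdorff.
apply: continuous_compact; last exact: segment_compact.
exact/continuous_subspaceT/segment_param_continuous.
Qed.

Lemma connected_segment : connected (segment e).
Proof.
apply: connected_continuous_connected; first exact: segment_connected.
exact/continuous_subspaceT/segment_param_continuous.
Qed.

End SegmentTopology.

(** * Trees built by attaching one segment at a time *)

Section Attachment.
Context (R : realType) (k n : nat) (T : 'I_n.+1 -> 'rV[R]_k * 'rV[R]_k).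
Context (q : 'I_n.+1 -> 'rV[R]_k).
Hypothesis T_neq : forall i, (T i).1 != (T i).2.
Hypothesis q_mem : forall j, segment (T j) (q j).
Hypothesis q_prev : forall j : 'I_n.+1, (0 < j)%N ->
  exists2 i : 'I_n.+1, (i < j)%N & segment (T i) (q j).
Hypothesis T_meet : forall i j : 'I_n.+1, (i < j)%N ->
  segment (T i) `&` segment (T j) `<=` [set q j].

Let prefix m := \bigcup_(i in [set i : 'I_n.+1 | (i < m)%N]) segment (T i).

(** Closedness is carried through the induction because [simple_closed_curveU] needs both pieces
    closed. *)
Let prefix_tree m : (m < n.+1)%N ->
  [/\ closed (prefix m.+1), connected (prefix m.+1) &
      ~ has_simple_closed_curve (prefix m.+1)].
Proof.
elim: m => [m0|m IH mn].
  have -> : prefix 1 = segment (T ord0).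
    apply/seteqP; split=> [x [i /= i0]|x Sx]; last by exists ord0.
    by rewrite (_ : i = ord0) //; apply/val_inj => /=; lia.
  split; [exact: closed_segment|exact: connected_segment|].
  exact: segment_no_simple_closed_curve.
have [|Pc Pconn Pscc] := IH; first exact: ltnW.
pose j := Ordinal mn.
have -> : prefix m.+2 = prefix m.+1 `|` segment (T j).
  apply/seteqP; split=> x.
    move=> [i /=]; rewrite ltnS leq_eqVlt => /predU1P[ij|im] Six.
      by right; rewrite (_ : j = i) //; exact/val_inj.
    by left; exists i.
  by case=> [[i im Six]|Sjx]; [exists i => //=; exact: ltnW|exists j => /=].
have Pq : prefix m.+1 (q j) by have [//|i ij] := @q_prev j; exists i.
(* The point [q j] is the same for all earlier edges, so the pairwise conditions combine into one
   for the whole prefix. *)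
have meet : prefix m.+1 `&` segment (T j) `<=` [set q j].
  by move=> x [[i im Six] Sjx]; exact: (@T_meet i j).
split.
- by apply: closedU => //; exact: closed_segment.
- by apply: connectedU => //; [exists (q j)|exact: connected_segment].
- move=> /(simple_closed_curveU Pc (@closed_segment _ _ _) Pq (q_mem j) meet).
  by case=> //; exact: segment_no_simple_closed_curve.
Qed.

Lemma is_tree_of_attachment : is_tree T.
Proof.
have supE : Defs.support T = prefix n.+1.
  by apply/seteqP; split=> x [i _ Six]; exists i => //=.
have [//|_ conn scc] := @prefix_tree n.
split; rewrite ?supE // => i j.
have meet1 (i' j' : 'I_n.+1) : (i' < j')%N ->
    is_subset1 (segment (T i') `&` segment (T j')).
  by move=> ij x y /(T_meet ij) -> /(T_meet ij) ->.
rewrite -val_eqE neq_ltn => /orP[/meet1//|/meet1].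
by rewrite setIC.
Qed.

End Attachment.

(** * Segments in space by coordinates *)

Section Space.
Context (R : realType).

Definition vec3 (a b c : R) : 'rV[R]_3 := \row_j [:: a; b; c]`_j.

Lemma row3P (p : 'rV[R]_3) a b c :
  p ord0 0 = a -> p ord0 1 = b -> p ord0 2 = c -> p = vec3 a b c.
Proof.
move=> p0 p1 p2; apply/rowP => -[[|[|[|//]]] ilt]; rewrite mxE /=.
- by rewrite -p0; congr (p _ _); exact/val_inj.
- by rewrite -p1; congr (p _ _); exact/val_inj.
- by rewrite -p2; congr (p _ _); exact/val_inj.
Qed.

Lemma segment_vec3 t a b c a' b' c' x y z : 0 <= t <= 1 ->
  (1 - t) * a + t * a' = x -> (1 - t) * b + t * b' = y ->
  (1 - t) * c + t * c' = z ->
  segment (vec3 a b c, vec3 a' b' c') (vec3 x y z).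
Proof.
move=> t01 xE yE zE; exists t; first by rewrite /= in_itv.
by apply: row3P; rewrite !mxE.
Qed.

(** For numerical endpoints the premise is linear in [s] and [t]. Since it names no parameter of the
    meeting point, it covers disjoint segments too: their equations are contradictory. *)
Lemma segment_vec3_meet a b c a' b' c' d e f d' e' f' x y z :
  (forall s t, 0 <= s <= 1 -> 0 <= t <= 1 ->
    (1 - s) * a + s * a' = (1 - t) * d + t * d' ->
    (1 - s) * b + s * b' = (1 - t) * e + t * e' ->
    (1 - s) * c + s * c' = (1 - t) * f + t * f' ->
    [/\ (1 - t) * d + t * d' = x, (1 - t) * e + t * e' = y &
        (1 - t) * f + t * f' = z]) ->
  segment (vec3 a b c, vec3 a' b' c') `&` segment (vec3 d e f, vec3 d' e' f')
    `<=` [set vec3 x y z].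
Proof.
move=> H p [[s /= s01 <-] [t /= t01 tE]]; rewrite -tE.
have coord j : ((1 - s) *: vec3 a b c + s *: vec3 a' b' c') ord0 j =
    ((1 - t) *: vec3 d e f + t *: vec3 d' e' f') ord0 j by rewrite tE.
have [] := H s t; rewrite -?[_ <= _ <= _]/(_ \in `[_, _]) //.
- by move: (coord 0); rewrite !mxE.
- by move: (coord 1); rewrite !mxE.
- by move: (coord 2); rewrite !mxE.
- by move=> xE yE zE; apply: row3P; rewrite !mxE.
Qed.

End Space.

(** * The twelve edges *)

Section Edges.
Context (R : realType).

(** Listed in order of attachment: the path of three two-point edges, then three diagonals crossing
    one of these each, then six axis-parallel edges attached at grid points. *)
Definition edges : seq ('rV[R]_3 * 'rV[R]_3) :=
  [:: (vec3 2 0 1, vec3 2 4 (-1));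
      (vec3 (-1) (-2) 2, vec3 2 4 (-1));
      (vec3 (-1) (-2) 2, vec3 1 2 2);
      (vec3 2 0 0, vec3 2 2 2);
      (vec3 0 1 0, vec3 2 1 2);
      (vec3 0 2 2, vec3 2 0 2);
      (vec3 0 1 0, vec3 0 1 2);
      (vec3 0 1 0, vec3 2 1 0);
      (vec3 0 0 0, vec3 2 0 0);
      (vec3 1 0 0, vec3 1 0 2);
      (vec3 0 2 0, vec3 0 2 2);
      (vec3 0 2 1, vec3 2 2 1)].

(* The point where each edge meets the union of its predecessors; the first
   entry is arbitrary on the first edge. *)
Definition joints : seq 'rV[R]_3 :=
  [:: vec3 2 0 1; vec3 2 4 (-1); vec3 (-1) (-2) 2; vec3 2 (2 / 3) (2 / 3);
      vec3 (1 / 2) 1 (1 / 2); vec3 (2 / 3) (4 / 3) 2; vec3 0 1 0; vec3 0 1 0;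
      vec3 2 0 0; vec3 1 0 0; vec3 0 2 2; vec3 0 2 1].

Lemma edges_neq (i : 'I_12) : (edges`_i).1 != (edges`_i).2.
Proof.
case: i => -[|[|[|[|[|[|[|[|[|[|[|[|//]]]]]]]]]]]] ilt; apply/eqP => /rowP E;
  by move: (E 0) (E 1) (E 2); rewrite !mxE /=; lra.
Qed.

Lemma joints_mem (j : 'I_12) : segment (edges`_j) joints`_j.
Proof.
case: j => -[|[|[|[|[|[|[|[|[|[|[|[|//]]]]]]]]]]]] jlt /=.
(* The number is the position of the joint along its own edge. *)
- by apply: (@segment_vec3 _ 0); lra.
- by apply: (@segment_vec3 _ 1); lra.
- by apply: (@segment_vec3 _ 0); lra.
- by apply: (@segment_vec3 _ (1 / 3)); lra.
- by apply: (@segment_vec3 _ (1 / 4)); lra.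
- by apply: (@segment_vec3 _ (1 / 3)); lra.
- by apply: (@segment_vec3 _ 0); lra.
- by apply: (@segment_vec3 _ 0); lra.
- by apply: (@segment_vec3 _ 1); lra.
- by apply: (@segment_vec3 _ 0); lra.
- by apply: (@segment_vec3 _ 1); lra.
- by apply: (@segment_vec3 _ 0); lra.
Qed.

Lemma joints_prev (j : 'I_12) : (0 < j)%N ->
  exists2 i : 'I_12, (i < j)%N & segment (edges`_i) joints`_j.
Proof.
case: j => -[|[|[|[|[|[|[|[|[|[|[|[|//]]]]]]]]]]]] jlt // _ /=.
(* The ordinal is an earlier edge through the joint, the number the position of the joint along that
   edge. *)
- by exists (@Ordinal 12 0 isT) => //; apply: (@segment_vec3 _ 1); lra.
- by exists (@Ordinal 12 1 isT) => //; apply: (@segment_vec3 _ 0); lra.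
- by exists (@Ordinal 12 0 isT) => //; apply: (@segment_vec3 _ (1 / 6)); lra.
- by exists (@Ordinal 12 1 isT) => //; apply: (@segment_vec3 _ (1 / 2)); lra.
- by exists (@Ordinal 12 2 isT) => //; apply: (@segment_vec3 _ (5 / 6)); lra.
- by exists (@Ordinal 12 4 isT) => //; apply: (@segment_vec3 _ 0); lra.
- by exists (@Ordinal 12 4 isT) => //; apply: (@segment_vec3 _ 0); lra.
- by exists (@Ordinal 12 3 isT) => //; apply: (@segment_vec3 _ 0); lra.
- by exists (@Ordinal 12 8 isT) => //; apply: (@segment_vec3 _ (1 / 2)); lra.
- by exists (@Ordinal 12 5 isT) => //; apply: (@segment_vec3 _ 0); lra.
- by exists (@Ordinal 12 10 isT) => //; apply: (@segment_vec3 _ (1 / 2)); lra.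
Qed.

(** Each of the 66 pairs gives three linear equations in two parameters from [[0, 1]], which are
    either unsolvable or force the joint. *)
Lemma edges_meet (i j : 'I_12) : (i < j)%N ->
  segment (edges`_i) `&` segment (edges`_j) `<=` [set joints`_j].
Proof.
case: j => -[|[|[|[|[|[|[|[|[|[|[|[|//]]]]]]]]]]]] jlt;
  case: i => -[|[|[|[|[|[|[|[|[|[|[|[|//]]]]]]]]]]]] ilt //= _;
  apply: segment_vec3_meet => s t s01 t01 ex ey ez; split; lra.
Qed.

Lemma edges_cover (p : 'rV[R]_3) :
  grid p -> exists i : 'I_12, segment (edges`_i) p.
Proof.
move=> pG; rewrite (row3P erefl erefl erefl : p = vec3 _ _ _).
move: (pG 0) (pG 1) (pG 2); rewrite !inE.
move=> /or3P[] /eqP -> /or3P[] /eqP -> /or3P[] /eqP ->.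
(* The 27 points come in lexicographic order, each with an edge through it and its position
   there. *)
- by exists (@Ordinal 12 8 isT); apply: (@segment_vec3 _ 0); lra.
- by exists (@Ordinal 12 1 isT); apply: (@segment_vec3 _ (1 / 3)); lra.
- by exists (@Ordinal 12 2 isT); apply: (@segment_vec3 _ (1 / 2)); lra.
- by exists (@Ordinal 12 4 isT); apply: (@segment_vec3 _ 0); lra.
- by exists (@Ordinal 12 6 isT); apply: (@segment_vec3 _ (1 / 2)); lra.
- by exists (@Ordinal 12 6 isT); apply: (@segment_vec3 _ 1); lra.
- by exists (@Ordinal 12 10 isT); apply: (@segment_vec3 _ 0); lra.
- by exists (@Ordinal 12 10 isT); apply: (@segment_vec3 _ (1 / 2)); lra.
- by exists (@Ordinal 12 5 isT); apply: (@segment_vec3 _ 0); lra.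
- by exists (@Ordinal 12 8 isT); apply: (@segment_vec3 _ (1 / 2)); lra.
- by exists (@Ordinal 12 9 isT); apply: (@segment_vec3 _ (1 / 2)); lra.
- by exists (@Ordinal 12 9 isT); apply: (@segment_vec3 _ 1); lra.
- by exists (@Ordinal 12 7 isT); apply: (@segment_vec3 _ (1 / 2)); lra.
- by exists (@Ordinal 12 4 isT); apply: (@segment_vec3 _ (1 / 2)); lra.
- by exists (@Ordinal 12 5 isT); apply: (@segment_vec3 _ (1 / 2)); lra.
- by exists (@Ordinal 12 1 isT); apply: (@segment_vec3 _ (2 / 3)); lra.
- by exists (@Ordinal 12 11 isT); apply: (@segment_vec3 _ (1 / 2)); lra.
- by exists (@Ordinal 12 2 isT); apply: (@segment_vec3 _ 1); lra.
- by exists (@Ordinal 12 3 isT); apply: (@segment_vec3 _ 0); lra.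
- by exists (@Ordinal 12 0 isT); apply: (@segment_vec3 _ 0); lra.
- by exists (@Ordinal 12 5 isT); apply: (@segment_vec3 _ 1); lra.
- by exists (@Ordinal 12 7 isT); apply: (@segment_vec3 _ 1); lra.
- by exists (@Ordinal 12 3 isT); apply: (@segment_vec3 _ (1 / 2)); lra.
- by exists (@Ordinal 12 4 isT); apply: (@segment_vec3 _ 1); lra.
- by exists (@Ordinal 12 0 isT); apply: (@segment_vec3 _ (1 / 2)); lra.
- by exists (@Ordinal 12 11 isT); apply: (@segment_vec3 _ 1); lra.
- by exists (@Ordinal 12 3 isT); apply: (@segment_vec3 _ 1); lra.
Qed.

End Edges.

Theorem mainTheorem2 (R : realType) :
  exists T : 'I_12 -> 'rV[R]_3 * 'rV[R]_3, is_tree T /\ covers T (@grid R 3).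
Proof.
exists (fun i => (edges R)`_i); split; last exact: edges_cover.
apply: (@is_tree_of_attachment _ _ _ _ (fun j => (joints R)`_j)).
- exact: edges_neq.
- exact: joints_mem.
- exact: joints_prev.
- exact: edges_meet.
Qed.
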